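(* There exists a constant $\kappa_*<1$ such that $$\Gamma_{2^n}(B_p^n)\leq\kappa_*\quad\text{for all integers } n\geq2 \text{ and all } p\in[1,\infty].$$
   Context: For a convex body $K\subset\mathbb{R}^n$ (compact convex set with nonempty interior) and an integer $m\geq1$, $$\Gamma_m(K)=\inf\Big\{\gamma>0:\ \exists\, c_1,\ldots,c_m\in\mathbb{R}^n\ \text{such that}\ K\subseteq\bigcup_{i=1}^m(c_i+\gamma K)\Big\}.$$ $B_p^n=\{x\in\mathbb{R}^n:\ \|x\|_p\leq1\}$, where $\|\cdot\|_p$ is the standard $p$-norm on $\mathbb{R}^n$ (for $p=\infty$, the maximum norm). *)

(* Defs.v *)
From mathcomp Require Import all_boot all_order all_algebra.
From mathcomp Require Import all_classical all_reals all_analysis.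
Import Order.TTheory GRing.Theory Num.Theory numFieldNormedType.Exports.

Set Implicit Arguments.
Unset Strict Implicit.
Unset Printing Implicit Defensive.

Local Open Scope classical_set_scope.
Local Open Scope ring_scope.

Definition homothetic_cover (R : realType) (n m : nat) (K : set 'rV[R]_n)
    (gamma : R) : Prop :=
  exists c : 'I_m -> 'rV[R]_n,
    K `<=` \bigcup_(i in [set: 'I_m]) [set c i + gamma *: x | x in K].

(* The infimum is that of [R], which is 0 on the empty set; for [0 < m] the set
   is never empty, see [covering_functional_set_nonempty]. *)
Definition covering_functional (R : realType) (n m : nat) (K : set 'rV[R]_n)
    : R :=
  inf [set gamma : R | 0 < gamma /\ homothetic_cover m K gamma].

(* For [p = +oo] this is the norm of ['rV[R]_n] in the library, which is the
   maximum norm, see [pnorm_pinfty]. The value at [-oo] is irrelevant: only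
   [1 <= p] is meaningful. *)
Definition pnorm (R : realType) (n : nat) (p : \bar R) (x : 'rV[R]_n) : R :=
  match p with
  | r%:E => (\sum_(i < n) `|x ord0 i| `^ r) `^ r^-1
  | +oo%E => `|x|
  | -oo%E => 0
  end.

Definition pball (R : realType) (n : nat) (p : \bar R) : set 'rV[R]_n :=
  [set x | pnorm p x <= 1].

Arguments pball {R} n p.

Lemma covering_functional_set_nonempty (R : realType) (n m : nat)
    (K : set 'rV[R]_n) :
  (0 < m)%N -> [set gamma : R | 0 < gamma /\ homothetic_cover m K gamma] 1.
Proof.
move=> m_gt0; split; first exact: ltr01.
exists (fun=> 0) => x Kx; exists (Ordinal m_gt0) => //.
by exists x => //; rewrite scale1r add0r.
Qed.

Lemma pnorm_pinfty (R : realType) (n : nat) (x : 'rV[R]_n) :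
  pnorm +oo%E x = \big[Num.max/0]_(i < n) `|x ord0 i|.
Proof.
rewrite /pnorm /Num.norm/= mx_normrE.
apply/le_anti/andP; split.
  apply: bigmax_le => [|[i j] _ /=]; first exact: bigmax_ge_id.
  by rewrite ord1; apply: (le_bigmax _ (fun j => `|x ord0 j|)).
apply: bigmax_le => [|j _]; first exact: bigmax_ge_id.
exact: (le_bigmax _ (fun ij => `|x ij.1 ij.2|) (ord0, j)).
Qed.

(* Main.v *)
Require Import Defs.
From mathcomp Require Import all_boot all_order all_algebra.
From mathcomp Require Import all_classical all_reals all_analysis.
From mathcomp Require Import zify lra.
Import Order.TTheory GRing.Theory Num.Theory.
Local Open Scope ring_scope.

(* Put x = y / n^(1/p), so that the ball becomes \sum_i |y_i|^p <= n; three
   explicit families of at most 2^n centers suffice, with kappa = 1 - 1/2048.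

   - p <= 32. Round |y_i|^p down to k_i / 4 and stop as soon as the k_i add up
     to about n / 8. This removes a fixed fraction of \sum_i |y_i|^p, hence, as
     |a - b|^p <= |a^p - b^p|, of the p-th power of the distance, and there are
     at most 2^n signed vectors k of this kind.

   - n <= 4^r with 8 r <= p (or p = oo). Then n^(1/p) is at most 2^(1/4), and the
     2^n vectors (b/2) (+-1, ..., +-1) with b = n^(1/p) suffice.

   - 4^r <= n with 8 r <= p <= 8 (r + 1), 4 <= r. Again use the sign vectors, now
     with entries +-2^(-1/4). They fail only on the few coordinates with
     |y_i|^p >= S = 2^(6r), which are instead approximated by (k_i S)^(1/p) with
     \sum_i k_i <= n / S. The choice of k is paid for by not recording the signs
     on one of the 2^r residue classes of coordinates, one which carries at most
     its share n / 2^r of the sum; there the center is 0. *)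

(** * Binomial estimates for counting the centers *)

(** One term of the binomial expansion of [(X + 1) ^ N]; [X] stays free, to be tuned to the ratio of
    [N] to [k]. *)
Lemma leq_bin_expn (X N k : nat) : (k <= N)%N ->
  ('C(N, k) * X ^ (N - k) <= X.+1 ^ N)%N.
Proof.
move=> kN; rewrite -addn1 expnDn (bigD1 (Ordinal (kN : k < N.+1)%N)) //=.
by rewrite exp1n muln1 leq_addr.
Qed.

(** Bernoulli's inequality [(1 - 1 / (X + 1)) ^ j >= 1 - j / (X + 1)], cleared of denominators. *)
Lemma leq_expn_bernoulli (X j : nat) : (j <= X)%N ->
  (X.+1 ^ j * (X.+1 - j) <= X ^ j * X.+1)%N.
Proof.
elim: j => [|j IHj] jX; first by rewrite !expn0 subn0.
apply: (@leq_trans (X.+1 ^ j * (X * (X.+1 - j)))); last first.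
  by rewrite mulnCA expnS -mulnA leq_mul2l IHj ?orbT// ltnW.
rewrite expnSr -mulnA leq_mul2l; apply/orP; right; nia.
Qed.

Lemma leq_expnS_double (h : nat) : ((2 * h).+1 ^ h <= 2 * (2 * h) ^ h)%N.
Proof.
have := @leq_expn_bernoulli (2 * h) h ltac:(lia).
move: (_ ^ h)%N ((2 * h) ^ h)%N => a b; nia.
Qed.

Lemma leq_expl (m n e : nat) : (m <= n)%N -> (m ^ e <= n ^ e)%N.
Proof. by case: e => // e mn; rewrite leq_exp2r. Qed.

(** The bound [(1 + 1 / (2 h)) ^ h <= 2] raised to the power [q], after padding the exponent [N] up
    to [h * q]. *)
Lemma leq_expnS_double_pow (h q N : nat) : (0 < h)%N -> (N <= h * q)%N ->
  ((2 * h).+1 ^ N <= 2 ^ q * (2 * h) ^ N)%N.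
Proof.
move=> h0 Nhq; rewrite -(@leq_pmul2r ((2 * h) ^ (h * q - N))); last first.
  by rewrite expn_gt0 muln_gt0 h0.
rewrite -mulnA -expnD subnKC//.
apply: (@leq_trans ((2 * h).+1 ^ (h * q))).
  rewrite -[in leqRHS](subnKC Nhq) expnD leq_mul2l.
  by rewrite leq_expl ?orbT.
by rewrite !expnM -expnMn; apply: leq_expl; apply: leq_expnS_double.
Qed.

(** Counting for the third family: leaving one residue class unsigned saves a factor [2 ^ l], which
    must pay for choosing the class ([2 ^ r]) and the rounded vector (the binomial). *)
Lemma leq_bin_short (n r : nat) : (4 <= r)%N -> (4 ^ r <= n)%N ->
  (2 ^ r * 'C(n + n %/ 2 ^ (6 * r), n) <= 2 ^ (n %/ 2 ^ r))%N.
Proof.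
move=> r4 rn; set K := (n %/ _)%N; set l := (n %/ _)%N.
have m0 : (0 < 2 ^ r)%N by rewrite expn_gt0.
have rm : (2 * r + 4 <= 2 ^ r)%N.
  elim: r r4 {rn K l m0} => // r IHr; rewrite leq_eqVlt => /orP[/eqP <- //|].
  by rewrite ltnS => /IHr; rewrite expnS; lia.
have nl : (n < l.+1 * 2 ^ r)%N by rewrite -ltn_divLR.
have lm : (2 ^ r <= l)%N by rewrite leq_divRL// -expnMn.
have Kn : (K * 2 ^ (6 * r) <= n)%N by apply: leq_divM.
have Kr : (K * (r + 4) <= (l %/ 4).+1)%N.
  have l4 : (l.+1 <= (l %/ 4).+1 * 4)%N by rewrite ltn_ceil.
  have K4 : (K * 2 ^ r * 16 <= l.+1)%N.
    rewrite -(@leq_pmul2r (2 ^ r))//; apply: leq_trans (ltnW nl).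
    apply: leq_trans Kn; rewrite -!mulnA leq_mul2l; apply/orP; right.
    have -> : (6 * r = r + (r + (r * 4)))%N by lia.
    rewrite !expnD leq_mul2l; apply/orP; right.
    rewrite mulnC leq_mul2l; apply/orP; right.
    rewrite expnM; apply: (@leq_trans ((2 ^ 4) ^ 4)) => //.
    by apply: leq_expl; apply: leq_pexp2l.
  have : (K * (r + 4) <= K * 2 ^ r)%N.
    by rewrite leq_mul2l; apply/orP; right; lia.
  lia.
have K_le_n : (K <= n)%N by apply: leq_div.
have NK : (n + K <= 2 ^ (r + 3) * (l %/ 4).+1)%N.
  have l4 : (l.+1 <= (l %/ 4).+1 * 4)%N by rewrite ltn_ceil.
  rewrite expnD; nia.
have X0 : (0 < 2 ^ (r + 3))%N by rewrite expn_gt0.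
(* With [X = 2 ^ (r + 4)] and [q = l %/ 4 + 1], the binomial is at most [2 ^ q * X ^ K], hence at
   most [2 ^ (2 q)] by [Kr]; what remains is [r + 2 q <= l]. *)
have := @leq_bin_expn (2 * 2 ^ (r + 3)) (n + K) K (leq_addl _ _).
rewrite addnK => /leq_trans /(_ (leq_expnS_double_pow _ _ _ X0 NK)).
rewrite -expnS -addnS (expnD _ n K) mulnCA mulnC leq_pmul2l; last first.
  by rewrite !expn_gt0.
rewrite -[X in 'C(_, X)](addKn n K) bin_sub ?leq_addr//.
rewrite -expnM -expnD => CX.
apply: (@leq_trans (2 ^ r * 2 ^ ((l %/ 4).+1 + (r + 4) * K))).
  by rewrite leq_mul2l CX orbT.
rewrite -expnD leq_pexp2l//.
have : (r + 2 <= (l %/ 4) * 2)%N.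
  have : (2 ^ r %/ 4 <= l %/ 4)%N by apply: leq_div2r.
  have -> : (2 ^ r = 2 ^ (r - 2) * 4)%N.
    by rewrite -[4%N]/(2 ^ 2)%N -expnD subnK//; lia.
  rewrite mulnK//.
  have -> : (2 ^ (r - 2) = 2 ^ (r - 3) * 2)%N.
    by rewrite -expnSr; congr (2 ^ _)%N; lia.
  have : (2 ^ r = 2 ^ (r - 3) * 8)%N.
    by rewrite -[8%N]/(2 ^ 3)%N -expnD subnK//; lia.
  lia.
have : (l %/ 4 * 4 <= l)%N by apply: leq_divM.
rewrite mulnC in Kr; lia.
Qed.

(** Counting for [p <= 32]: the binomial is the number of [2 n]-tuples of naturals with sum [K]. *)
Lemma leq_bin_eighth (n K : nat) : (2 <= n)%N -> K = maxn 1 (n %/ 8) ->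
  ('C(n + n + K - 1, K) <= 2 ^ n)%N.
Proof.
move=> n2 defK; have [n16|n16] := ltnP n 16.
  have -> : K = 1%N by lia.
  rewrite bin1 addnK; elim: n n2 {n16 defK} => // n IHn.
  rewrite leq_eqVlt => /orP[/eqP <- //|]; rewrite ltnS => /IHn.
  by rewrite expnS; lia.
have KE : K = (n %/ 8)%N by lia.
rewrite {}KE {K defK}; set K := (n %/ 8)%N.
have nE := divn_eq n 8; rewrite -/K in nE; set rho := (n %% 8)%N in nE.
have K1 : (1 <= K)%N by rewrite /K; lia.
have KN : (K <= n + n + K - 1)%N by lia.
have := @leq_bin_expn 8 _ _ KN.
have -> : (n + n + K - 1 - K = (n + n).-1)%N by lia.
move=> C9; rewrite -(@leq_pmul2r (8 ^ (n + n))) ?expn_gt0//.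
have -> : (8 ^ (n + n) = 8 * 8 ^ (n + n).-1)%N by rewrite -expnS prednK//; lia.
rewrite mulnCA; apply: (@leq_trans (8 * 9 ^ (n + n + K - 1))).
  by rewrite leq_mul2l C9.
apply: (@leq_trans (9 ^ (n + n + K))).
  have -> : (n + n + K = (n + n + K - 1).+1)%N by lia.
  by rewrite expnS subn1 /= leq_mul2r orbT.
rewrite -expnS prednK; last lia.
(* As [n = 8 K + rho], the exponents split so that [9 ^ 4 <= 2 ^ 13], [9 <= 2 ^ 4] and
   [9 ^ 2 <= 2 ^ 7] apply factor by factor. *)
have -> : (n + n + K = 4 * (4 * K) + K + 2 * rho)%N by lia.
have -> : (2 ^ n * 8 ^ (n + n) = 2 ^ (13 * (4 * K) + 4 * K + 7 * rho))%N.
  by rewrite -[8%N]/(2 ^ 3)%N -expnM -expnD; congr (2 ^ _)%N; lia.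
rewrite (expnD 9 (_ + K)) (expnD 9 _ K).
rewrite (expnD 2 (_ + 4 * K)) (expnD 2 _ (4 * K)).
rewrite (expnM 9 4) (expnM 9 2) (expnM 2 13) (expnM 2 4) (expnM 2 7).
by do 2?apply: leq_mul; apply: leq_expl.
Qed.

(** Built one unit at a time: while the sum of [g] is below that of [f], some coordinate still has
    room. *)
Lemma sum_nat_truncate (I : finType) (f : I -> nat) (K : nat) :
  (K <= \sum_i f i)%N ->
  exists g : I -> nat, (forall i, g i <= f i)%N /\ (\sum_i g i = K)%N.
Proof.
elim: K => [_|K IHK Kf]; first by exists (fun=> 0%N); split => //; rewrite big1.
have [g [gf gK]] := IHK (ltnW Kf).
have [i gi] : exists i, (g i < f i)%N.
  apply/existsP; apply: contraTT Kf; rewrite negb_exists => /forallP fg.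
  rewrite -leqNgt -gK; apply: leq_sum => i _; rewrite leqNgt; exact: fg.
exists (fun j => g j + (j == i))%N; split=> [j|].
  by case: (eqVneq j i) => [->|_]; rewrite ?addn1 ?addn0.
by rewrite big_split /= gK -big_mkcond big_pred1_eq addn1.
Qed.

(** * Reduction to finite families of centers and sums of p-th powers *)

Lemma covering_functional_le (R : realType) (n m : nat) (K : set 'rV[R]_n)
    (kappa : R) (I : finType) (D : {set I}) (c : I -> 'rV[R]_n) :
  0 < kappa -> (#|D| <= m)%N ->
  (forall x, K x -> exists2 i, i \in D & K (kappa^-1 *: (x - c i))) ->
  covering_functional m K <= kappa.
Proof.
move=> k0 Dm Kc; apply: ge_inf; first by exists 0 => g [/ltW].
(* If [D] has fewer than [m] elements, the default 0 fills the surplus centers. *)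
split=> //; exists (fun j => nth 0 [seq c i | i <- enum D] j) => x /Kc[i iD Ki].
have iS : (index i (enum D) < #|D|)%N by rewrite cardE index_mem mem_enum.
exists (Ordinal (leq_trans iS Dm)) => //=.
exists (kappa^-1 *: (x - c i)) => //.
rewrite (nth_map i) -?cardE// nth_index ?mem_enum//.
by rewrite scalerA divff ?gt_eqF// scale1r addrC subrK.
Qed.

(** Scaling by [b = n ^ (1 / p)], for which [b ^ p = n], makes the mean of the p-th powers at most
    1; no p-th root is left. *)
Lemma covering_pball_le (R : realType) (n : nat) (p kappa : R) (I : finType)
    (D : {set I}) (c : I -> 'I_n -> R) :
  (0 < n)%N -> 0 < p -> 0 < kappa -> (#|D| <= 2 ^ n)%N ->
  (forall y : 'I_n -> R, \sum_i `|y i| `^ p <= n%:R ->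
     exists2 z, z \in D & \sum_i `|y i - c z i| `^ p <= kappa `^ p * n%:R) ->
  covering_functional (2 ^ n) (pball n p%:E) <= kappa.
Proof.
move=> n0 p0 k0 Dn Dc; set b : R := n%:R `^ p^-1.
have n0R : 0 < n%:R :> R by rewrite ltr0n.
have b0 : 0 < b by rewrite powR_gt0.
have bp : b `^ p = n%:R by rewrite -powRrM mulVf ?gt_eqF// powRr1 ?ltW.
apply: (@covering_functional_le _ _ _ _ _ _ D
  (fun z => \row_i (b^-1 * c z i))) => // x.
rewrite /pball /= => xB.
have sum_ge0 (f : 'I_n -> R) : 0 <= \sum_i `|f i| `^ p.
  by apply: sumr_ge0 => i _; exact: powR_ge0.
have ballP (f : 'I_n -> R) :
    ((\sum_i `|f i| `^ p) `^ p^-1 <= 1) = (\sum_i `|f i| `^ p <= 1).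
  apply/idP/idP => H.
    have -> : \sum_i `|f i| `^ p = ((\sum_i `|f i| `^ p) `^ p^-1) `^ p.
      by rewrite -powRrM mulVf ?gt_eqF// powRr1.
    have <- : 1 `^ p = 1 :> R by rewrite powR1.
    by rewrite ge0_ler_powR ?nnegrE ?powR_ge0// ltW.
  have <- : 1 `^ p^-1 = 1 :> R by rewrite powR1.
  by rewrite ge0_ler_powR ?nnegrE ?invr_ge0// ltW.
have scaleP (a : R) (f g : 'I_n -> R) : 0 < a -> (forall i, g i = a * f i) ->
    \sum_i `|g i| `^ p = a `^ p * \sum_i `|f i| `^ p.
  move=> a0 gf; rewrite mulr_sumr; apply: eq_bigr => i _.
  by rewrite gf normrM powRM// gtr0_norm.
rewrite ballP in xB.
have [|z zD zy] := Dc (fun i => b * x ord0 i).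
  by rewrite (scaleP b (fun i => x ord0 i))// bp ler_piMr.
exists z => //; rewrite ballP.
rewrite (scaleP (kappa * b)^-1 (fun i => b * x ord0 i - c z i)); last 2 first.
- by rewrite invr_gt0 mulr_gt0.
- move=> i; rewrite !mxE invfM -mulrA; congr (_ * _).
  by rewrite mulrBr mulKf ?gt_eqF.
have <- : (kappa * b)^-1 `^ p * (kappa `^ p * n%:R) = 1.
  rewrite -bp -powRM ?ltW// -powRM ?invr_ge0 ?mulr_ge0 ?ltW//.
  by rewrite mulVf ?powR1// gt_eqF// mulr_gt0.
by rewrite ler_wpM2l// powR_ge0.
Qed.

(** * Coordinatewise inequalities and the constant [kappa] *)

Lemma normr_subr_sign (R : realDomainType) (y e : R) :
  `|y - (-1) ^+ (y < 0)%R * e| = `| `|y| - e|.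
Proof.
have [y0|y0] := ltP y 0; last by rewrite mul1r (ger0_norm y0).
by rewrite expr1 mulN1r opprK (ltr0_norm y0) -[LHS]normrN opprD.
Qed.

(** For [0 <= c <= a], [(c / a) ^ p <= c / a]. Applying this to [c = b] and [c = a - b] and adding
    gives [b ^ p + (a - b) ^ p <= a ^ p]. *)
Lemma powR_dist_le (R : realType) (p a b : R) : 1 <= p -> 0 <= a -> 0 <= b ->
  `|a - b| `^ p <= `|a `^ p - b `^ p|.
Proof.
move=> p1; have p0 : 0 < p by apply: lt_le_trans p1.
wlog ab : a b / b <= a => [hw a0 b0|a0 b0].
  have [ba|/ltW ab] := leP b a; first exact: hw.
  by rewrite distrC [leRHS]distrC; exact: hw.
have [->|an0] := eqVneq a 0.
  rewrite powR0 ?gt_eqF// !sub0r !normrN (ger0_norm b0).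
  by rewrite ger0_norm ?powR_ge0.
have agt0 : 0 < a by rewrite lt_neqAle eq_sym an0.
rewrite ger0_norm ?subr_ge0// ger0_norm ?subr_ge0; last first.
  by rewrite ge0_ler_powR ?nnegrE// ltW.
have frac (c : R) : 0 <= c -> c <= a -> c `^ p <= a `^ p * (c / a).
  move=> c0 ca; have [->|cn0] := eqVneq c 0.
    by rewrite mul0r mulr0 powR0 ?gt_eqF.
  have -> : c `^ p = a `^ p * (c / a) `^ p.
    by rewrite -powRM ?divr_ge0// ?ltW// mulrC divfK.
  rewrite ler_wpM2l ?powR_ge0// ge1r_powR//.
  have cgt0 : 0 < c by rewrite lt_neqAle eq_sym cn0.
  by rewrite divr_gt0//= ler_pdivrMr// mul1r.
have h1 := frac _ b0 ab; have h2 : (a - b) `^ p <= a `^ p * ((a - b) / a).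
  by apply: frac; rewrite ?subr_ge0// gerBl.
have e : a `^ p * (b / a) + a `^ p * ((a - b) / a) = a `^ p.
  by rewrite -mulrDr -mulrDl addrC subrK divff// mulr1.
lra.
Qed.

(* 2048 = 32 * 64: for p <= 32 the p-th power of the distance loses 1/64. *)
Definition kappa {R : realType} : R := 1 - 2048^-1.

Lemma kappa_expn32 {R : realType} : 63 / 64 <= (@kappa R) ^+ 32.
Proof.
have bern k : 1 - k%:R / 2048 <= (@kappa R) ^+ k.
  elim: k => [|k IHk]; first by rewrite mul0r subr0 expr0.
  rewrite exprS; apply: (@le_trans _ _ (kappa * (1 - k%:R / 2048))); last first.
    by rewrite ler_wpM2l// /kappa; lra.
  have : 0 <= k%:R :> R by [].
  by rewrite /kappa -natr1; lra.
by apply: le_trans (bern 32%N); lra.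
Qed.

(** * Sign vectors at half the coordinate bound *)

Lemma covering_pball_pinfty (R : realType) (n : nat) :
  covering_functional (2 ^ n) (pball n +oo%E) <= kappa :> R.
Proof.
have k0 : (0 : R) < kappa by rewrite /kappa; lra.
apply: (@covering_functional_le R _ _ _ _ {set 'I_n} [set: {set 'I_n}]
  (fun A => \row_i ((-1) ^+ (i \in A) * 2^-1))) => //.
  by rewrite -powersetT card_powerset cardsT card_ord.
move=> x; rewrite /pball /= => x1; exists [set i | x ord0 i < 0].
  exact: finset.in_setT.
have xi i : `|x ord0 i| <= 1.
  apply: le_trans x1; rewrite [in leRHS]/Num.norm/= mx_normrE.
  exact: (le_bigmax _ (fun ij => `|x ij.1 ij.2|) (ord0, i)).
rewrite [leLHS]/Num.norm/= mx_normrE.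
apply: bigmax_le => // -[j i] _ /=; rewrite (ord1 j) !mxE finset.in_set normrM.
rewrite normr_subr_sign gtr0_norm ?invr_gt0// mulrC ler_pdivrMr// mul1r.
rewrite ler_norml.
by move: (xi i) (normr_ge0 (x ord0 i)); rewrite /kappa; lra.
Qed.

Lemma covering_pball_large (R : realType) (n r : nat) (p : R) :
  (0 < n)%N -> (0 < r)%N -> 8 * r%:R <= p -> (n <= 4 ^ r)%N ->
  covering_functional (2 ^ n) (pball n p%:E) <= kappa.
Proof.
move=> n0 r0 rp nr; set b : R := n%:R `^ p^-1.
have k0 : (0 : R) < kappa by rewrite /kappa; lra.
have r1 : 1 <= r%:R :> R by rewrite ler1n.
have p0 : 0 < p by lra.
have n0R : 0 < n%:R :> R by rewrite ltr0n.
have b0 : 0 < b by rewrite powR_gt0.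
have bp : b `^ p = n%:R by rewrite -powRrM mulVf ?gt_eqF// powRr1 ?ltW.
apply: (@covering_pball_le R _ _ _ {set 'I_n} [set: {set 'I_n}]
  (fun A i => (-1) ^+ (i \in A) * (b / 2))) => //.
  by rewrite -powersetT card_powerset cardsT card_ord.
move=> y yn; exists [set i | y i < 0]; first exact: finset.in_setT.
have yb i : `|y i| <= b.
  have -> : `|y i| = (`|y i| `^ p) `^ p^-1.
    by rewrite -powRrM mulfV ?gt_eqF// powRr1.
  have p0le := ltW p0; rewrite ge0_ler_powR ?nnegrE ?invr_ge0 ?powR_ge0//.
  apply: le_trans yn; by rewrite (bigD1 i)//= lerDl sumr_ge0.
(* The error is at most [n * (b / 2) ^ p], that is [n * n / 2 ^ p], so this is exactly what is
   needed. It follows from [n <= 4 ^ r], [8 r <= p] and [4 <= (3 / 2) ^ 8]. *)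
have nk : n%:R <= (2 * kappa) `^ p.
  apply: (@le_trans _ _ ((2 * kappa) `^ (8 * r%:R))); last first.
    by rewrite ler_powR// /kappa; lra.
  have kk : (0 : R) <= 2 * kappa by rewrite /kappa; lra.
  rewrite powRrM -[8]/(8%:R) !powR_mulrn ?exprn_ge0//.
  apply: (@le_trans _ _ (4 ^+ r)); first by rewrite -natrX ler_nat.
  rewrite lerXn2r ?nnegrE ?exprn_ge0//.
  apply: (@le_trans _ _ ((3 / 2) ^+ 8)); first by lra.
  by rewrite lerXn2r ?nnegrE// /kappa; lra.
apply: (@le_trans _ _ (\sum_(i < n) (b / 2) `^ p)).
  apply: ler_sum => i _; rewrite finset.in_set normr_subr_sign.
  rewrite ge0_ler_powR ?nnegrE ?divr_ge0 ?(ltW p0) ?(ltW b0)//.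
  rewrite ler_norml; move: (yb i) (normr_ge0 (y i)); lra.
rewrite sumr_const card_ord -[leLHS]mulr_natr ler_wpM2r//.
rewrite powRM ?invr_ge0 ?(ltW b0)// bp.
have e : kappa `^ p = (2 * kappa) `^ p * 2^-1 `^ p :> R.
  by rewrite -powRM ?mulr_ge0 ?invr_ge0 ?(ltW k0)// mulrAC mulfV ?mul1r.
by rewrite e ler_wpM2r ?powR_ge0.
Qed.

(** * Exponents up to 32: rounding with a bounded total *)

Lemma covering_pball_small (R : realType) (n : nat) (p : R) :
  (2 <= n)%N -> 1 <= p -> p <= 32 ->
  covering_functional (2 ^ n) (pball n p%:E) <= kappa.
Proof.
case: n => [//|n'] n2 p1 p32; set n := n'.+1 in n2 *.
have k0 : (0 : R) < kappa by rewrite /kappa; lra.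
have p0 : 0 < p by lra.
set K := maxn 1 (n %/ 8).
have K16 : (n <= 16 * K)%N by rewrite /K; lia.
have Kn : (K <= n)%N by rewrite /K; lia.
(* A signed vector is coded by two halves, its positive and its negative parts; the total is exactly
   [K]. *)
pose D := [set t : (n + n).-tuple 'I_K.+1 | (\sum_(i <- t) i)%N == K].
pose w (k : nat) : R := (k%:R / 4) `^ p^-1.
have w0 k : 0 <= w k by exact: powR_ge0.
have wp k : w k `^ p = k%:R / 4.
  by rewrite -powRrM mulVf ?gt_eqF// powRr1// divr_ge0.
apply: (@covering_pball_le R n p kappa _ D
  (fun t i => w (tnth t (lshift n i)) - w (tnth t (rshift n i)))) => //.
  rewrite (card_ord_partitions (n' + n) K).
  apply: leq_trans (leq_bin_eighth n K n2 erefl).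
  have -> : (n + n + K - 1 = n' + n + K)%N by rewrite /n; lia.
  by rewrite -[X in (_ <= 'C(_, X))%N](addKn (n' + n) K) bin_sub ?leq_addr.
move=> y yn.
have [g [gK gE]] : exists g : 'I_n -> nat, (\sum_i g i = K)%N /\
    \sum_i `| `|y i| `^ p - (g i)%:R / 4| <= n%:R - K%:R / 4.
  have [small|big] := leP (\sum_i `|y i| `^ p) (n%:R / 2).
    (* A small sum leaves slack: all [K] units may go to one coordinate, at a cost of at most
       [K / 4]. *)
    exists (fun i => if i == ord0 then K else 0%N); split.
      by rewrite -big_mkcond big_pred1_eq.
    apply: (@le_trans _ _ (n%:R / 2 + K%:R / 4)); last first.
      by have : K%:R <= n%:R :> R by [rewrite ler_nat]; lra.
    apply: (@le_trans _ _ (\sum_i (`|y i| `^ p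
        + (if i == ord0 then K else 0%N)%:R / 4))).
      apply: ler_sum => i _; rewrite (le_trans (ler_normB _ _))//.
      by rewrite (ger0_norm (powR_ge0 _ _)) (@ger0_norm _ (_ / 4)) ?divr_ge0.
    rewrite big_split /= lerD// -mulr_suml -natr_sum.
    by rewrite -big_mkcond big_pred1_eq.
  (* Here the floors of [4 |y_i| ^ p] add up to at least [4 (n / 2) - n = n >= K]; cutting them down
     to total [K] lowers the sum by exactly [K / 4]. *)
  have /sum_nat_truncate[g [gf gK]] :
      (K <= \sum_i Num.truncn (4 * `|y i| `^ p))%N.
    rewrite (leq_trans Kn)// -(ler_nat R) natr_sum.
    apply: (@le_trans _ _ (\sum_i (4 * `|y i| `^ p - 1))).
      rewrite sumrB sumr_const card_ord -mulr_sumr; lra.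
    by apply: ler_sum => i _; rewrite lerBlDr natr1 ltW// truncnS_gt.
  exists g; split=> //.
  rewrite -gK natr_sum mulr_suml.
  apply: le_trans (lerB yn (lexx _)); rewrite -sumrB.
  apply: ler_sum => i _; rewrite ger0_norm// subr_ge0 ler_pdivrMr// mulrC.
  by rewrite -truncn_ge_nat ?mulr_ge0 ?powR_ge0.
pose f (i : 'I_(n + n)) : nat :=
  match fintype.split i with
  | inl j => if y j < 0 then 0%N else g j
  | inr j => if y j < 0 then g j else 0%N
  end.
have gleK j : (g j < K.+1)%N by rewrite ltnS -gK (bigD1 j)//= leq_addr.
have fK i : (f i < K.+1)%N.
  by rewrite /f; case: (fintype.split i) => j; case: ifP.
pose t := [tuple Ordinal (fK i) | i < n + n].
have fl i : f (lshift n i) = if y i < 0 then 0%N else g i.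
  by rewrite /f (unsplitK (inl i)).
have fr i : f (rshift n i) = if y i < 0 then g i else 0%N.
  by rewrite /f (unsplitK (inr i)).
exists t.
  rewrite finset.in_set big_tuple.
  under eq_bigr do rewrite tnth_mktuple.
  rewrite /= big_split_ord /= -big_split /= -[X in _ == X]gK; apply/eqP.
  by apply: eq_bigr => i _; rewrite fl fr; case: ifP; rewrite ?addn0.
apply: (@le_trans _ _ (\sum_i `| `|y i| `^ p - (g i)%:R / 4|)).
  apply: ler_sum => i _; rewrite !tnth_mktuple /= fl fr.
  have w00 : w 0%N = 0 by rewrite /w mul0r powR0// invr_eq0 gt_eqF.
  have -> : `|y i - (w (if y i < 0 then 0%N else g i) -
      w (if y i < 0 then g i else 0%N))| = `| `|y i| - w (g i)|.
    rewrite -normr_subr_sign; case: ifP => _.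
      by rewrite w00 sub0r expr1 mulN1r.
    by rewrite w00 subr0 mul1r.
  by rewrite (le_trans (powR_dist_le _ _ _ _ p1 _ _)) ?wp.
apply: (le_trans gE).
have kp : 63 / 64 <= kappa `^ p :> R.
  apply: (le_trans kappa_expn32); rewrite -powR_mulrn ?(ltW k0)//.
  by rewrite ger_powR// k0 /kappa; lra.
apply: (@le_trans _ _ (63 / 64 * n%:R)); last by rewrite ler_wpM2r.
have : n%:R <= 16 * K%:R :> R by rewrite -natrM ler_nat.
lra.
Qed.

(** * Large exponents and dimensions: dropping the signs of one residue class *)

Definition residue (m n : nat) (m0 : (0 < m)%N) (i : 'I_n) : 'I_m :=
  Ordinal (ltn_pmod i m0).

Definition off_class (m n : nat) (m0 : (0 < m)%N) (j : 'I_m) : {set 'I_n} :=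
  [set i | residue m n m0 i != j].

(** The omitted class contains the [n %/ m] distinct indices [q * m + j]. *)
Lemma card_off_class (m n : nat) (m0 : (0 < m)%N) (j : 'I_m) :
  (#|off_class m n m0 j| <= n - n %/ m)%N.
Proof.
have jn (q : 'I_(n %/ m)) : (q * m + j < n)%N.
  apply: (@leq_trans (q.+1 * m)); first by rewrite mulSn addnC ltn_add2r.
  by rewrite (leq_trans _ (leq_divM n m))// leq_mul2r ltn_ord orbT.
pose g q := Ordinal (jn q).
have g_inj : injective g.
  move=> q q' [/eqP]; rewrite eqn_add2r eqn_pmul2r// => /eqP; exact: val_inj.
have := cardsC (off_class m n m0 j); rewrite card_ord => /esym nE.
rewrite [X in (_ <= X - _)%N]nE leq_subRL; last first.
  by rewrite -nE leq_div.
rewrite addnC leq_add2l -[X in (X <= _)%N]card_ord.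
rewrite -cardsT -(card_imset _ g_inj).
apply: subset_leq_card; apply/fintype.subsetP => i /imsetP[q _ ->].
rewrite finset.in_setC finset.in_set negbK -val_eqE /=.
by rewrite modnMDl modn_small.
Qed.

Lemma card_off_class_subsets (m n : nat) (m0 : (0 < m)%N) :
  (#|[set z : 'I_m * {set 'I_n} | z.2 \subset off_class m n m0 z.1]|
    <= m * 2 ^ (n - n %/ m))%N.
Proof.
rewrite -sum1_card; under eq_bigl do rewrite finset.in_set.
rewrite -(pair_big_dep xpredT
  (fun j (A : {set 'I_n}) => A \subset off_class m n m0 j) (fun _ _ => 1%N)) /=.
rewrite -[X in (_ <= X * _)%N]card_ord -sum_nat_const; apply: leq_sum => j _.
have -> : (\sum_(A : {set 'I_n} | A \subset off_class m n m0 j) 1 =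
    #|powerset (off_class m n m0 j)|)%N.
  by rewrite -sum1_card; apply: eq_bigl => A; rewrite powersetE.
by rewrite card_powerset leq_pexp2l// card_off_class.
Qed.

(** Averaging: if every class exceeded its share, summing over the [m] classes would exceed [m]
    times the total. *)
Lemma exists_light_class (R : realDomainType) (m n : nat) (m0 : (0 < m)%N)
    (u : 'I_n -> R) :
  exists j : 'I_m, m%:R * \sum_(i | residue m n m0 i == j) u i <= \sum_i u i.
Proof.
apply/existsP; apply: contraT; rewrite negb_exists => /forallP heavy.
have : \sum_(j < m) \sum_i u i <
    \sum_(j < m) m%:R * \sum_(i | residue m n m0 i == j) u i.
  apply: ltr_sum => [|j _]; last by rewrite ltNge heavy.
  by apply/hasP; exists (Ordinal m0); rewrite ?mem_index_enum.
rewrite sumr_const card_ord -mulr_sumr -[X in X < _]mulr_natl.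
by rewrite (partition_big (residue m n m0) xpredT) //= ltxx.
Qed.

Lemma normr_sub_mid (R : realFieldType) (x a : R) :
  0 <= x -> x <= 2 * a -> `|x - a| <= a.
Proof. by move=> x0 xa; rewrite ler_norml; lra. Qed.

Lemma normr_sub_near (R : realFieldType) (x v : R) :
  v <= x -> x <= 3 / 2 * v -> `|x - v| <= x * 2^-1.
Proof. by move=> vx xv; rewrite ler_norml; lra. Qed.

Lemma covering_pball_mid (R : realType) (n r : nat) (p : R) :
  (4 <= r)%N -> 8 * r%:R <= p -> p <= 8 * r.+1%:R -> (4 ^ r <= n)%N ->
  covering_functional (2 ^ n) (pball n p%:E) <= kappa.
Proof.
move=> r4 rp pr rn.
have r2 : (2 <= r)%N by apply: leq_trans r4.
(* An equality at [r = 4]; it lets [kappa ^ 20 >= 1 / 2] give [kappa ^ p >= 2 ^ (2 - r)] below. *)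
have r20 : (8 * r.+1 <= 20 * (r - 2))%N by move: r4; clear; lia.
have k0 : (0 : R) < kappa by rewrite /kappa; lra.
have r4R : 4 <= r%:R :> R by rewrite (ler_nat R 4).
have p32 : 32 <= p by lra.
have p0 : 0 < p by lra.
have p0le := ltW p0.
have p2 : 2%:R <= p by lra.
have [le_1_3h le_2_3h] : 1 <= 3 / 2 :> R /\ 2 <= (3 / 2) ^+ 2 :> R by lra.
have n0 : (0 < n)%N by apply: leq_trans rn; rewrite expn_gt0.
set m := (2 ^ r)%N; have m0 : (0 < m)%N by rewrite expn_gt0.
set S := (2 ^ (6 * r))%N; have S0 : (0 < S)%N by rewrite expn_gt0.
have S0R : 0 < S%:R :> R by rewrite ltr0n.
set K := (n %/ S)%N.
pose a : R := 2 `^ (- 4^-1).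
have a0 : 0 < a by rewrite powR_gt0.
(* The value 0 of [k] marks a coordinate below the threshold [S], which gets the sign-vector entry
   [a]. *)
pose w (k : nat) : R := if k == 0%N then a else (k%:R * S%:R) `^ p^-1.
pose D1 := [set z : 'I_m * {set 'I_n} | z.2 \subset off_class m n m0 z.1].
pose D2 := [set t : n.-tuple 'I_K.+1 | (\sum_(i <- t) i <= K)%N].
apply: (@covering_pball_le R n p kappa _ (finset.setX D1 D2)
  (fun z i => if residue m n m0 i == z.1.1 then 0
              else (-1) ^+ (i \in z.1.2) * w (tnth z.2 i))) => //.
  rewrite cardsX (card_partial_ord_partitions n K).
  apply: leq_trans (leq_mul (card_off_class_subsets m n m0) (leqnn _)) _.
  rewrite mulnAC (leq_trans (leq_mul (leq_bin_short n r r4 rn) (leqnn _)))//.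
  by rewrite -expnD subnKC// leq_div.
move=> y yn; pose u i := `|y i| `^ p.
have u0 i : 0 <= u i by exact: powR_ge0.
have [j jle] := exists_light_class R m n m0 u.
pose k i := Num.truncn (u i / S%:R).
have kle i : (k i)%:R * S%:R <= u i.
  by rewrite -ler_pdivlMr// truncn_le divr_ge0.
have kgt i : u i < (k i).+1%:R * S%:R.
  by rewrite -ltr_pdivrMr// truncnS_gt.
have kK : (\sum_i k i <= K)%N.
  rewrite leq_divRL// -(ler_nat R) natrM natr_sum mulr_suml.
  by apply: le_trans yn; apply: ler_sum.
have kK1 i : (k i < K.+1)%N.
  by rewrite ltnS (leq_trans _ kK)// (bigD1 i)//= leq_addr.
pose t := [tuple Ordinal (kK1 i) | i < n].
have tK : (\sum_(i <- t) i <= K)%N.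
  by rewrite big_tuple; under eq_bigr do rewrite tnth_mktuple.
exists (j, [set i | (y i < 0) && (residue m n m0 i != j)], t).
  rewrite finset.in_setX !finset.in_set /=; apply/andP; split.
    by apply/fintype.subsetP => i; rewrite !finset.in_set => /andP[].
  exact: tK.
have half_p : 2^-1 `^ p <= 2^-1 ^+ r :> R.
  rewrite -powR_mulrn ?invr_ge0// ger_powR//; last lra.
  by apply/andP; split; lra.
have ap : a `^ p <= 2^-1 ^+ r.
  have -> : 2^-1 ^+ r = 2 `^ (- r%:R) :> R by rewrite powRN powR_mulrn// exprVn.
  rewrite /a -powRrM.
  by rewrite ler_powR ?ler1n//; lra.
(* Since [8 r <= p], [S ^ (1 / p) <= 2 ^ (3 / 4) = 2 a]: a coordinate below the threshold is within
   [a] of its center. *)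
have Sa : S%:R `^ p^-1 <= 2 * a.
  rewrite natrX -powR_mulrn// -powRrM -[X in X * a]powRr1// -powRD; last first.
    by apply/implyP.
  rewrite ler_powR ?ler1n// ler_pdivrMr// natrM; lra.
have err i : residue m n m0 i != j ->
    `| `|y i| - w (k i)| `^ p <= 2^-1 ^+ r + u i * 2^-1 ^+ r.
  move=> _; have yE : `|y i| = u i `^ p^-1.
    by rewrite -powRrM mulfV ?gt_eqF// powRr1.
  rewrite /w; case: eqP => [ki0|/eqP ki0].
    apply: (@le_trans _ _ (a `^ p)); last first.
      by rewrite (le_trans ap)// lerDl mulr_ge0// exprn_ge0// invr_ge0.
    rewrite ge0_ler_powR ?nnegrE ?(ltW a0)//.
    apply: normr_sub_mid => //; apply: le_trans Sa.
    rewrite yE ge0_ler_powR ?nnegrE ?invr_ge0// ?ltW//.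
    by have := kgt i; rewrite ki0 mul1r.
  set v := (k i)%:R * S%:R.
  have v0 : 0 <= v by rewrite mulr_ge0.
  have lo : v `^ p^-1 <= `|y i|.
    by rewrite yE ge0_ler_powR ?nnegrE ?invr_ge0// kle.
  (* As [k i >= 1], [u i < (k i + 1) S <= 2 v], and [2 ^ (1 / p) <= 3 / 2] because [p >= 2]. *)
  have hi : `|y i| <= 3 / 2 * v `^ p^-1.
    rewrite yE; apply: (@le_trans _ _ ((2 * v) `^ p^-1)).
      rewrite ge0_ler_powR ?nnegrE ?invr_ge0 ?mulr_ge0//.
      apply: ltW; apply: (lt_le_trans (kgt i)).
      rewrite mulrA ler_wpM2r// -natrM ler_nat.
      by rewrite mul2n -addnn -addn1 leq_add2l lt0n.
    rewrite powRM// ler_wpM2r ?powR_ge0//.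
    apply: (@le_trans _ _ (((3 / 2) ^+ 2) `^ p^-1)).
      by rewrite ge0_ler_powR ?nnegrE ?invr_ge0// ?exprn_ge0 ?divr_ge0.
    rewrite -powR_mulrn ?divr_ge0// -powRrM -[leRHS]powRr1 ?divr_ge0//.
    by rewrite ler_powR// ler_pdivrMr// mul1r.
  apply: (@le_trans _ _ ((`|y i| * 2^-1) `^ p)).
    rewrite ge0_ler_powR ?nnegrE ?mulr_ge0 ?invr_ge0//.
    exact: normr_sub_near.
  rewrite powRM ?invr_ge0// -/(u i) (le_trans (ler_wpM2l (u0 i) half_p))//.
  by rewrite lerDr exprn_ge0// invr_ge0.
(* The omitted class, the constant terms and the terms in [u i] each contribute at most
   [n / 2 ^ r]. *)
apply: (@le_trans _ _ (\sum_(i | residue m n m0 i == j) u i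
    + \sum_i (2^-1 ^+ r + u i * 2^-1 ^+ r))).
  rewrite (big_mkcond (fun i => residue m n m0 i == j)) -big_split /=.
  apply: ler_sum => i _; case: ifP => [_|/negbT ij].
    by rewrite subr0 lerDl addr_ge0 ?mulr_ge0 ?exprn_ge0 ?invr_ge0.
  rewrite add0r finset.in_set ij andbT tnth_mktuple /= normr_subr_sign.
  exact: err.
have h0 : 0 <= 2^-1 ^+ r :> R by rewrite exprn_ge0 ?invr_ge0.
have light : \sum_(i | residue m n m0 i == j) u i <= n%:R * 2^-1 ^+ r.
  rewrite exprVn ler_pdivlMr ?exprn_gt0// mulrC -natrX.
  exact: le_trans jle yn.
rewrite big_split /= sumr_const card_ord -mulr_suml -[_ *+ n]mulr_natl.
have uh : (\sum_i u i) * 2^-1 ^+ r <= n%:R * 2^-1 ^+ r by rewrite ler_wpM2r.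
have kp : 4 * 2^-1 ^+ r <= kappa `^ p :> R.
  have k1 : 2^-1 <= kappa ^+ 20 :> R.
    apply: (@le_trans _ _ (kappa ^+ 32)).
      by apply: le_trans kappa_expn32; lra.
    by rewrite ler_wiXn2l// ?(ltW k0)// /kappa; lra.
  apply: (@le_trans _ _ (kappa ^+ (20 * (r - 2)))).
    rewrite exprM (le_trans _ (@lerXn2r _ _ _ _ _ _ k1))//
      ?nnegrE ?invr_ge0 ?exprn_ge0 ?(ltW k0)//.
    have -> : 2^-1 ^+ r = 2^-1 ^+ (r - 2) * 2^-1 ^+ 2 :> R.
      by rewrite -exprD subnK.
    by move: (_ ^+ (r - 2)) => z; lra.
  apply: (@le_trans _ _ (kappa ^+ (8 * r.+1))).
    by rewrite ler_wiXn2l ?(ltW k0)// /kappa; lra.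
  rewrite -powR_mulrn ?(ltW k0)// ger_powR//; last by rewrite natrM.
  by rewrite k0 /kappa; lra.
apply: (@le_trans _ _ (4 * 2^-1 ^+ r * n%:R)); last by rewrite ler_wpM2r.
move: light uh; set T := \sum_(i | _) _; set U := (\sum_i u i) * _.
have : 0 <= n%:R * 2^-1 ^+ r :> R by rewrite mulr_ge0.
move: (2^-1 ^+ r) => z; move: (n%:R) => N; lra.
Qed.

(** * Choice of the family according to [p] and [n] *)

Theorem theorem1p5 (R : realType) :
  exists kappa : R, kappa < 1 /\
    forall (n : nat) (p : \bar R), (2 <= n)%N -> (1 <= p)%E ->
      covering_functional (2 ^ n) (pball n p) <= kappa.
Proof.
exists kappa; split=> [|n p n2]; first by rewrite /kappa; lra.
have n0 : (0 < n)%N by apply: leq_trans n2.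
case: p => [p| |]//=; last by move=> _; exact: covering_pball_pinfty.
rewrite lee_fin => p1; have [p32|p32] := leP p 32.
  exact: covering_pball_small.
(* Then [8 r <= p <= 8 (r + 1)], with [r >= 4] because [p > 32]; the last two families are separated
   by [n] against [4 ^ r]. *)
pose r := Num.truncn (p / 8).
have p8 : 0 <= p / 8 by lra.
have r4 : (4 <= r)%N by rewrite truncn_ge_nat//; lra.
have rp : 8 * r%:R <= p by have := truncn_le (p / 8); rewrite p8 -/r; lra.
have pr : p <= 8 * r.+1%:R by have := truncnS_gt (p / 8); rewrite -/r; lra.
have [nr|/ltnW nr] := leqP n (4 ^ r).
  by apply: covering_pball_large rp nr => //; apply: leq_trans r4.
exact: covering_pball_mid r4 rp pr nr.
Qed.
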